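(* Let $A\in \mathbb{R}^{n\times n}$, $p\in [n]$, $\omega=p/n$, $x\in \overline{Z}_p=\mathtt{Zone}(\overline{D}_p)$, and let $L=A\otimes_\omega \overline{D}_p$ and $U=A\otimes_\omega(-\overline{D}_p)^\top$. If $i,j\in [n]$ satisfy $A(i,j)=L(i,j)=U(i,j)$, then $(i,j)$ is an active entry of $A$ with respect to $\omega$ and $x$.
   Context: Notation: $[n]=\{1,\dots,n\}$. For $\omega=p/n$, $p\in[n]$, $A\in\mathbb{R}^{n\times n}$ and $x\in\mathbb{R}^n$, the vector $A\otimes_\omega x$ has $i$-th entry equal to the $p$-th smallest element (counted with multiplicity) of the multiset $\{A(i,1)+x_1,\dots,A(i,n)+x_n\}$; for a matrix $B$, $A\otimes_\omega B$ is obtained by applying this to each column of $B$. Thus $L(i,j)$ is the $p$-th smallest of $\{A(i,k)+\overline{D}_p(k,j):k\in[n]\}$ and $U(i,j)$ is the $p$-th smallest of $\{A(i,k)-\overline{D}_p(j,k):k\in[n]\}$. An entry $(i,j)$ is called active for $A$ with respect to $x$ and $\omega$ if $(A\otimes_\omega x)_i=A(i,j)+x_j$, and inactive otherwise. For $D\in(\mathbb{R}\cup\{-\infty\})^{n\times n}$ with zero diagonal, $\mathtt{Zone}(D)=\{x\in\mathbb{R}^n : x_i-x_j\ge D(i,j)\ \forall i,j\in[n]\}$. For $D\in(\mathbb{R}\cup\{-\infty\})^{n\times n}$ and real row vectors $a,b$ of length $n$, put $$\mathtt{MinMaxValue}(D,a,b\mid p,n+1-p)=\min_{S_1,S_2}\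 \max_{i\in S_1,\,j\in S_2}\bigl(D(i,j)+a_i-b_j\bigr),$$ where $S_1$ ranges over all $p$-element subsets and $S_2$ over all $(n+1-p)$-element subsets of $[n]$. The sequence $\{D_p^k\}_{k\ge0}$ is defined by $D_p^0=I_n$ (the max-plus identity: zero diagonal, $-\infty$ off the diagonal) and $D_p^{k+1}(i,j)=\mathtt{MinMaxValue}(D_p^k,A_i,A_j\mid p,n+1-p)$ for all $i,j\in[n]$, where $A_i$ denotes the $i$-th row of $A$. The entrywise limit $\overline{D}_p=\lim_{k\to\infty}D_p^k$ exists (the sequence is entrywise nondecreasing and bounded above, with finite entries for $k\ge1$). *)

(* Defs.v *)
From mathcomp Require Import all_boot all_order all_algebra.
From mathcomp Require Import all_classical all_reals all_analysis.
From mathcomp Require Import lra zify.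

Set Implicit Arguments.
Unset Strict Implicit.
Unset Printing Implicit Defensive.

Import Order.TTheory GRing.Theory Num.Theory.

Local Open Scope classical_set_scope.
Local Open Scope ring_scope.

(* [p] counts from 1; the value is meaningful for [1 <= p <= size s]. *)
Definition psmallest (R : realType) (p : nat) (s : seq R) : R :=
  nth 0 (sort <=%R s) p.-1.

(* The product [A (x)_omega x] with [omega = p / n], parametrized by [p]. *)
Definition omulv (R : realType) (n p : nat) (A : 'M[R]_n) (x : 'cV[R]_n) :
    'cV[R]_n :=
  \col_i psmallest p [seq A i k + x k 0 | k <- enum 'I_n].

Definition omulmx (R : realType) (n m p : nat) (A : 'M[R]_n)
    (B : 'M[R]_(n, m)) : 'M[R]_(n, m) :=
  \matrix_(i, j) omulv p A (col j B) i 0.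

Definition active (R : realType) (n p : nat) (A : 'M[R]_n) (x : 'cV[R]_n)
    (i j : 'I_n) : Prop :=
  omulv p A x i 0 = A i j + x j 0.

(* Matrices over R u {-oo} are represented over [\bar R]; the value [+oo]
   never occurs in the matrices considered below. *)
Definition Zone (R : realType) (n : nat) (D : 'M[\bar R]_n) : set 'cV[R]_n :=
  [set x | forall i j, (D i j <= (x i 0 - x j 0)%:E)%E].

(* The neutral elements [+oo] and [-oo] are the values of the empty minimum
   and maximum; for [1 <= p, q <= n] both ranges are nonempty. *)
Definition MinMaxValue (R : realType) (n : nat) (D : 'M[\bar R]_n)
    (a b : 'rV[R]_n) (p q : nat) : \bar R :=
  \big[Order.min/+oo%E]_(S : {set 'I_n} * {set 'I_n}
                          | (#|S.1| == p) && (#|S.2| == q))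
    \big[Order.max/-oo%E]_(ij : 'I_n * 'I_n
                            | (ij.1 \in S.1) && (ij.2 \in S.2))
      (D ij.1 ij.2 + (a 0 ij.1)%:E - (b 0 ij.2)%:E)%E.

Definition maxplus1 (R : realType) (n : nat) : 'M[\bar R]_n :=
  \matrix_(i, j) (if i == j then 0%E else -oo%E).

Fixpoint Dseq (R : realType) (n p : nat) (A : 'M[R]_n) (k : nat) :
    'M[\bar R]_n :=
  if k is k'.+1 then
    \matrix_(i, j) MinMaxValue (Dseq p A k') (row i A) (row j A) p (n.+1 - p)
  else maxplus1 R n.

(* The limit is taken in [\bar R]; [Dbar_cvg] below shows that it exists and
   is finite when [1 <= p <= n], so that [fine] loses no information. *)
Definition Dbar (R : realType) (n p : nat) (A : 'M[R]_n) : 'M[R]_n :=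
  \matrix_(i, j) fine (limn (fun k => Dseq p A k i j)).

Section DbarCvg.
Variables (R : realType) (n p : nat) (A : 'M[R]_n).
Hypothesis hp : (1 <= p <= n)%N.

Let sets_meet (S1 S2 : {set 'I_n}) :
  #|S1| = p -> #|S2| = (n.+1 - p)%N -> exists k, (k \in S1) && (k \in S2).
Proof.
move=> c1 c2; have /set0Pn[k] : S1 :&: S2 != finset.set0.
  rewrite -card_gt0.
  have := cardsUI S1 S2; rewrite c1 c2.
  have : (#|S1 :|: S2| <= n)%N by rewrite -[leqRHS]card_ord max_card.
  by move: hp; lia.
by rewrite inE => ?; exists k.
Qed.

Let split_sets (f : 'I_n -> R) : exists v (S1 S2 : {set 'I_n}),
  [/\ #|S1| = p, #|S2| = (n.+1 - p)%N,
      {in S1, forall k, f k <= v} & {in S2, forall k, v <= f k}].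
Proof.
have n_gt0 : (0 < n)%N by move: hp; lia.
pose o := Ordinal n_gt0.
pose r : rel 'I_n := relpre f <=%R.
have rT : total r by move=> x y; rewrite /r /=; exact: le_total.
have rtr : transitive r by move=> y x z; exact: le_trans.
pose s := sort r (enum 'I_n).
have ss : size s = n by rewrite size_sort size_enum_ord.
have us : uniq s by rewrite sort_uniq enum_uniq.
have sr : sorted r s by exact: sort_sorted.
have lef a b : (a <= b < n)%N -> f (nth o s a) <= f (nth o s b).
  move=> /andP[ab bn]; rewrite -[_ <= _]/(r _ _).
  by apply: (sorted_leq_nth rtr _ o sr) => //;
    rewrite ?inE ?ss //; [move=> x; rewrite /r /= | lia].
exists (f (nth o s p.-1)), [set x in take p s], [set x in drop p.-1 s].
split.
- by rewrite cardsE (card_uniqP (take_uniq _ us)) size_takel // ss; move: hp; lia.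
- by rewrite cardsE (card_uniqP (drop_uniq _ us)) size_drop ss; move: hp; lia.
- move=> k; rewrite inE => /(nthP o)[a].
  rewrite size_takel ?ss => [alt|]; last by move: hp; lia.
  by rewrite nth_take // => <-; apply: lef; move: hp alt; lia.
- move=> k; rewrite inE => /(nthP o)[a].
  by rewrite size_drop ss nth_drop => alt <-; apply: lef; move: hp; lia.
Qed.

Let MinMaxValue_homo (D E : 'M[\bar R]_n) (a b : 'rV[R]_n) q :
  (forall i j, D i j <= E i j)%E ->
  (MinMaxValue D a b p q <= MinMaxValue E a b p q)%E.
Proof.
move=> DE; apply: le_bigmin2 => S _; apply: le_bigmax2 => ij _.
by apply: leeB => //; apply: leeD.
Qed.

Let c : R := \sum_(ij : 'I_n * 'I_n) `|A ij.1 ij.2|.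

Let A_le i j : `|A i j| <= c.
Proof.
by rewrite /c (bigD1 (i, j)) //= lerDl; apply: sumr_ge0.
Qed.

Let Dseq1_ge i j : ((if i == j then 0 else - (c + c))%:E <= Dseq p A 1 i j)%E.
Proof.
rewrite mxE; apply: le_bigmin => [|[S1 S2] /= /andP[/eqP c1 /eqP c2]].
  exact: leey.
have [k /andP[k1 k2]] := sets_meet c1 c2.
apply: (@bigmax_sup _ _ _ _ (k, k)); first by rewrite /= k1 k2.
rewrite /= !mxE eqxx add0e -EFinB lee_fin; case: eqP => [->|_].
  by rewrite subrr.
by have := A_le i k; have := A_le j k; rewrite !ler_norml; lra.
Qed.

Let Dseq_nd i j : nondecreasing_seq (fun k => Dseq p A k i j).
Proof.
apply/nondecreasing_seqP => k; elim: k i j => [|k IH] i j.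
  apply: le_trans (Dseq1_ge i j); rewrite mxE; case: eqP => // _.
  exact: leNye.
by rewrite [Dseq _ _ k.+1]/= mxE [Dseq _ _ k.+2]/= mxE; exact: MinMaxValue_homo.
Qed.

Let Dseq_le k : exists x : 'cV[R]_n,
  Zone (Dseq p A k) x /\ (forall i j, (0 < k)%N -> x i 0 - x j 0 <= c + c).
Proof.
elim: k => [|k [x [Zx _]]].
  exists 0; split=> // i j; rewrite !mxE subrr; case: eqP => // _.
  exact: leNye.
have /choice[y Hy] := fun i => split_sets (fun l => A i l + x l 0).
exists (\col_i y i); split=> i j; rewrite !mxE;
  have [S1 [T1 [cS1 cT1 S1P T1P]]] := Hy i;
  have [S2 [T2 [cS2 cT2 S2P T2P]]] := Hy j.
- apply: (@bigmin_inf _ _ _ _ (S1, T2)); first by rewrite /= cS1 cT2 !eqxx.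
  apply: bigmax_le => [|[a b] /= /andP[aS bT]]; first exact: leNye.
  have := Zx a b; rewrite !mxE.
  case: (Dseq _ _ _ _ _) => [d| |] //=; rewrite ?lee_fin ?leNye //.
  by have := S1P _ aS; have := T2P _ bT; rewrite /=; lra.
- have [a /andP[aS aT]] := sets_meet cS2 cT1.
  have := S2P _ aS; have := T1P _ aT.
  by have := A_le i a; have := A_le j a; rewrite !ler_norml /=; lra.
Qed.

Lemma Dbar_cvg i j : Dseq p A k i j @[k --> \oo] --> (Dbar p A i j)%:E.
Proof.
have cv := ereal_nondecreasing_is_cvgn (@Dseq_nd i j).
rewrite mxE fineK //; set l := limn _.
have lo : (Dseq p A 1 i j <= l)%E.
  apply: lime_ge => //; exists 1%N => // k /= k1; exact: (Dseq_nd i j k1).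
have hi : (l <= (c + c)%:E)%E.
  apply: lime_le => //; exists 1%N => // k /= k1.
  have [x [Zx xP]] := Dseq_le k.
  by apply: le_trans (Zx i j) _; rewrite lee_fin xP.
rewrite fin_numElt (lt_le_trans (ltNyr _) (le_trans (Dseq1_ge i j) lo)).
exact: le_lt_trans hi (ltry _).
Qed.

End DbarCvg.

(* Main.v *)
(* Membership of x in the zone means D k j <= x k - x j <= - D j k, so the
   p-th smallest value of A i k + x k - x j over k lies between L i j and
   U i j, both of which equal A i j. *)
Require Import Defs.
From mathcomp Require Import all_boot all_order all_algebra.
From mathcomp Require Import all_classical all_reals all_analysis.
From mathcomp Require Import lra.

Import Order.TTheory GRing.Theory Num.Theory.

Local Open Scope classical_set_scope.
Local Open Scope ring_scope.

(** Order statistics are monotone and commute with shifts ([psmallest_shift_le]), so the zone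
    inequalities squeeze the value at [i] between [L i j + x j] and [U i j + x j]; both equal
    [A i j + x j]. *)

Lemma psmallest_le (R : realType) (p : nat) (s : seq R) (v : R) :
  (1 <= p <= size s)%N -> (psmallest p s <= v) = (p <= count (<= v) s)%N.
Proof.
case: p => // p /= ps; rewrite /psmallest /=.
have s_sorted : sorted <=%R (sort <=%R s) by exact: sort_le_sorted.
rewrite -(count_sort <=%R); apply/idP/idP; last exact: nth_count_le.
apply: contraTT; rewrite -leqNgt -ltNge => le_p.
by apply: nth_count_gt; rewrite // size_sort le_p.
Qed.

(** By [psmallest_le] it suffices to count: at least [p] indices have [g k] at most the [p]-th
    smallest [g]-value, and each of them has [f k + c] below it too. *)
Lemma psmallest_shift_le (R : realType) (T : Type) (p : nat) (s : seq T)
    (f g : T -> R) (c : R) :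
  (1 <= p <= size s)%N -> (forall k, f k + c <= g k) ->
  psmallest p (map f s) + c <= psmallest p (map g s).
Proof.
move=> ps fg; rewrite -lerBrDr psmallest_le ?size_map //.
have := lexx (psmallest p (map g s)).
rewrite {1}psmallest_le ?size_map // => /leq_trans; apply.
rewrite !count_map; apply: sub_count => k /= gk.
by rewrite lerBrDr (le_trans (fg k)).
Qed.

Theorem proposition3p13 (R : realType) (n p : nat) (hp : (1 <= p <= n)%N)
    (A : 'M[R]_n) (x : 'cV[R]_n) (hx : Zone (map_mx EFin (Dbar p A)) x)
    (i j : 'I_n) :
  let L := omulmx p A (Dbar p A) in
  let U := omulmx p A (- Dbar p A)^T in
  A i j = L i j -> L i j = U i j -> active p A x i j.
Proof.
move=> L U AL LU; have AU : A i j = U i j by rewrite AL.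
have D_le k l : Dbar p A k l <= x k 0 - x l 0.
  by have := hx k l; rewrite mxE lee_fin.
have ps : (1 <= p <= size (enum 'I_n))%N by rewrite size_enum_ord.
rewrite /active; apply/le_anti/andP; split.
  (* Upper bound, with shift [- x j]. *)
  rewrite AU -lerBlDr !mxE; apply: psmallest_shift_le => // k.
  by have := D_le j k; rewrite !mxE; lra.
(* Lower bound, with shift [x j]. *)
rewrite AL !mxE; apply: psmallest_shift_le => // k.
by have := D_le k j; rewrite !mxE; lra.
Qed.
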